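(* Let $d\ge 1$ and let $(\mathbb{Z},\sigma)$ be the connection graph whose underlying graph is the one-dimensional lattice $\mathbb{Z}$ (vertices $\mathbb{Z}$, edges $\{x,x+1\}$, all edge weights equal to $1$), with a connection $\sigma:E(\mathbb{Z})\to O(d)$. Let $H_t^{\sigma}=\exp(-t\mathcal{L}^{\sigma})$ be its connection heat kernel. Then for every $x\in\mathbb{Z}$ and every positive integer $a$: (1) $H_t^{\sigma}(x,x)=\sum_{k\ge 0}\frac{C_{2k}^{k}}{k!}\left(\frac{-t}{2}\right)^k I_{d\times d}$; (2) $H^{\sigma}_t(x,x+a)=(-1)^a \sum_{k\ge 0}\frac{C_{2k}^{k+a}}{k!} \left(-\frac{t}{2}\right)^k\sigma_{x,x+1}\sigma_{x+1,x+2}\cdots\sigma_{x+a-1,x+a}$ and $H^{\sigma}_t(x,x-a)=(-1)^a \sum_{k\ge 0}\frac{C_{2k}^{k+a}}{k!} \left(-\frac{t}{2}\right)^k\sigma_{x,x-1}\sigma_{x-1,x-2}\cdots\sigma_{x-(a-1),x-a}$.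
   Context: A connection on a graph assigns to each ordered pair of adjacent vertices $(u,v)$ a matrix $\sigma_{uv}\in O(d)$ with $\sigma_{vu}=\sigma_{uv}^{-1}$. For $(\mathbb{Z},\sigma)$ with unit weights every vertex has degree $2$, and the normalized connection Laplacian $\mathcal{L}^{\sigma}=I-(D^{\sigma})^{-1/2}A^{\sigma}(D^{\sigma})^{-1/2}$ acts on functions $f:\mathbb{Z}\to\mathbb{R}^d$ by $(\mathcal{L}^{\sigma}f)(x)=f(x)-\tfrac12\sigma_{x,x-1}f(x-1)-\tfrac12\sigma_{x,x+1}f(x+1)$. It is viewed as an infinite block matrix with $d\times d$ blocks indexed by $\mathbb{Z}\times\mathbb{Z}$ (diagonal blocks $I_{d\times d}$, block $(x,x\pm1)$ equal to $-\tfrac12\sigma_{x,x\pm1}$). The connection heat kernel is $H_t^{\sigma}=\exp(-t\mathcal{L}^{\sigma})=\sum_{k\ge0}\frac{(-t)^k}{k!}(\mathcal{L}^{\sigma})^k$, and $H_t^{\sigma}(x,y)$ denotes its $d\times d$ block in position $(x,y)$. $C_{m}^{j}$ denotes the binomial coefficient $\binom{m}{j}$, taken to be $0$ when $j>m$. *)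

(* Defs.v *)
From HB Require Import structures.
From mathcomp Require Import all_boot all_order all_algebra.
From mathcomp Require Import all_classical all_reals all_analysis.

Set Implicit Arguments.
Unset Strict Implicit.
Unset Printing Implicit Defensive.

Import Order.TTheory GRing.Theory Num.Theory.
Import numFieldNormedType.Exports.

Local Open Scope classical_set_scope.
Local Open Scope ring_scope.

Definition orthogonal_mx (R : realType) (d : nat) (Q : 'M[R]_d) : Prop :=
  Q^T *m Q = 1%:M /\ Q *m Q^T = 1%:M.

(* Only the values of sigma on adjacent ordered pairs are meaningful; the
   others are unconstrained and masked by adj in connection_adjacency. *)
Definition is_connection (R : realType) (d : nat) (V : Type) (adj : rel V)
    (sigma : V -> V -> 'M[R]_d) : Prop :=
  forall u v, adj u v ->
    orthogonal_mx (sigma u v) /\ sigma v u = invmx (sigma u v).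

Section BlockMatrices.
Variables (R : realType) (d : nat) (V : choiceType).

Definition block_mx_on := V -> V -> 'M[R]_d.

Definition bdiag (c : V -> R) : block_mx_on :=
  fun x y => if x == y then (c x)%:M else 0.

(* The sum over z is a finitely supported one: it is 0 by convention when
   infinitely many terms are nonzero, which never happens over a locally
   finite graph, where the matrices below have finitely supported rows. *)
Definition bmul (A B : block_mx_on) : block_mx_on :=
  fun x y => \sum_(z \in [set: V]) A x z *m B z y.

Fixpoint bexp (A : block_mx_on) (k : nat) : block_mx_on :=
  if k is k'.+1 then bmul A (bexp A k') else bdiag (fun=> 1).

Variables (adj : rel V) (w : V -> V -> R) (sigma : V -> V -> 'M[R]_d).

Definition degree (x : V) : R := \sum_(y \in [set y | adj x y]) w x y.

Definition connection_adjacency : block_mx_on :=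
  fun x y => if adj x y then w x y *: sigma x y else 0.

Definition normalized_laplacian : block_mx_on :=
  let Dinvsqrt := bdiag (fun x => (Num.sqrt (degree x))^-1) in
  fun x y => bdiag (fun=> 1) x y
             - bmul (bmul Dinvsqrt connection_adjacency) Dinvsqrt x y.

End BlockMatrices.

Arguments bdiag {R d V} c x y.

Definition exp_term (R : realType) (d : nat) (V : choiceType)
    (L : block_mx_on R d V) (t : R) (x y : V) : nat -> 'M[R]_d :=
  fun k => ((- t) ^+ k / k`!%:R) *: bexp L k x y.

(* Block (x, y) of exp (- t L). *)
Definition heat_kernel (R : realType) (d : nat) (V : choiceType)
    (L : block_mx_on R d V) (t : R) (x y : V) : 'M[R]_d :=
  limn (series (exp_term L t x y)).

Definition latticeZ_adj : rel int := fun x y => (y == x + 1) || (y == x - 1).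

Definition latticeZ_laplacian (R : realType) (d : nat)
    (sigma : int -> int -> 'M[R]_d) : block_mx_on R d int :=
  normalized_laplacian latticeZ_adj (fun _ _ => 1) sigma.

Definition binom_term (R : realType) (a : nat) (t : R) : nat -> R :=
  fun k => 'C((2 * k)%N, (k + a)%N)%:R / k`!%:R * (- (t / 2)) ^+ k.

Lemma latticeZ_degree (R : realType) (x : int) :
  degree latticeZ_adj (fun _ _ => 1 : R) x = 2.
Proof.
rewrite /degree.
have -> : [set y | latticeZ_adj x y] = [set` [:: x + 1; x - 1]].
  by apply/seteqP; split=> y /=; rewrite /latticeZ_adj !inE.
have u : uniq [:: x + 1; x - 1] by rewrite /= mem_seq1 (inj_eq (addrI x)).
rewrite -fsbig_seq // !big_cons big_nil /=.
by rewrite addr0.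
Qed.

Lemma bmul_bdiagl (R : realType) (d : nat) (V : choiceType) (c : V -> R)
    (A : block_mx_on R d V) x y : bmul (bdiag c) A x y = c x *: A x y.
Proof.
rewrite /bmul -(@fsbig_widen _ _ _ _ [set x])//=.
  by rewrite fsbig_set1 /bdiag eqxx mul_scalar_mx.
by move=> z [_ /eqP zx]; rewrite /= /bdiag eq_sym (negbTE zx) mul0mx.
Qed.

Lemma bmul_bdiagr (R : realType) (d : nat) (V : choiceType) (c : V -> R)
    (A : block_mx_on R d V) x y : bmul A (bdiag c) x y = c y *: A x y.
Proof.
rewrite /bmul -(@fsbig_widen _ _ _ _ [set y])//=.
  by rewrite fsbig_set1 /bdiag eqxx mul_mx_scalar.
by move=> z [_ /eqP zx]; rewrite /= /bdiag (negbTE zx) mulmx0.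
Qed.

Lemma latticeZ_laplacianE (R : realType) (d : nat)
    (sigma : int -> int -> 'M[R]_d) (x y : int) :
  latticeZ_laplacian sigma x y =
    if x == y then 1%:M
    else if latticeZ_adj x y then - (2^-1 *: sigma x y) else 0.
Proof.
rewrite /latticeZ_laplacian /normalized_laplacian bmul_bdiagr bmul_bdiagl.
rewrite !latticeZ_degree /connection_adjacency /bdiag scale1r.
have h : (Num.sqrt 2)^-1 * (Num.sqrt 2)^-1 = 2^-1 :> R.
  by rewrite -invfM -expr2 sqr_sqrtr.
have [<-|xy] := eqVneq x y.
  rewrite /latticeZ_adj -[X in X == x + 1]addr0 -[X in X == x - 1]addr0.
  by rewrite !(inj_eq (addrI x)) /= !scaler0 subr0.
by rewrite scalerA h sub0r; case: ifP => // _; rewrite scaler0 oppr0.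
Qed.

(* Main.v *)
Require Import Defs.
From HB Require Import structures.
From mathcomp Require Import all_boot all_order all_algebra.
From mathcomp Require Import ring zify.
From mathcomp Require Import all_classical all_reals all_analysis.
Import Order.TTheory GRing.Theory Num.Theory.
Import numFieldNormedType.Exports.
Local Open Scope classical_set_scope.
Local Open Scope ring_scope.

(* Splitting off the first step of the walk gives a recursion in k for the
   blocks of the powers L^k.  Since a backtracking step cancels the holonomy
   (sigma_{x,x-s} sigma_{x-s,x} = 1), induction shows that block (x, x + s a),
   s = 1 or -1, of L^k is (-1)^a 2^-k C(2k, k + a) times the parallel transport
   from x to x + s a: the scalar recursion is Pascal's rule applied twice.  The
   exponential series then reduces to a scalar one, dominated by that of
   exp(2|t|). *)

(** For a target at distance [a.+1], the three terms come from the neighbour nearer to it, the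
    vertex itself and the farther neighbour. *)
Lemma bin_double_succ k a :
  'C(2 * k.+1, k.+1 + a.+1) =
    ('C(2 * k, k + a) + 2 * 'C(2 * k, k + a.+1) + 'C(2 * k, k + a.+2))%N.
Proof.
have -> : (2 * k.+1 = (2 * k).+2)%N by lia.
by rewrite addSn !addnS !binS; lia.
Qed.

(** When the target is the vertex itself, both neighbours lie at distance 1 from it, hence the
    factor 2 on ['C(2 * k, k.+1)]. *)
Lemma bin_double_succ0 k :
  'C(2 * k.+1, k.+1) = (2 * 'C(2 * k, k) + 2 * 'C(2 * k, k.+1))%N.
Proof.
have -> : (2 * k.+1 = (2 * k).+2)%N by lia.
case: k => [|k]; first by rewrite muln0 !binS !bin0n.
rewrite [LHS]binS binS [X in (_ + X)%N]binS.
(* Symmetry of the row [2 * k.+1] about its middle entry [k.+1]. *)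
have -> : 'C(2 * k.+1, k) = 'C(2 * k.+1, k.+2).
  by rewrite -[RHS]bin_sub; [congr 'C(_, _); lia | lia].
by lia.
Qed.

Section Transport.
Variables (R : realType) (d : nat) (sigma : int -> int -> 'M[R]_d).

(** The sign [s], 1 or -1, is the direction of travel, so that one argument serves both rays from
    [x]; the case [a = 0] is the identity. *)
Definition transport (s x : int) (a : nat) : 'M[R]_d :=
  \big[mulmx/1%:M]_(i < a) sigma (x + s * i%:Z) (x + s * i.+1%:Z).

Lemma transportS s x a :
  transport s x a.+1 = sigma x (x + s) *m transport s (x + s) a.
Proof.
rewrite /transport big_ord_recl mulr0 addr0 mulr1; congr (_ *m _).
by apply: eq_bigr => i _; congr (sigma _ _); rewrite lift0 !intS; ring.
Qed.

Lemma bmul_latticeZ_laplacian (B : block_mx_on R d int) (s x y : int) :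
  s = 1 \/ s = -1 ->
  bmul (latticeZ_laplacian sigma) B x y =
    B x y - 2^-1 *: (sigma x (x + s) *m B (x + s) y)
          - 2^-1 *: (sigma x (x - s) *m B (x - s) y).
Proof.
move=> hs; rewrite /bmul -(@fsbig_widen _ _ _ _ [set` [:: x; x + s; x - s]])//=.
  rewrite -fsbig_seq; last by rewrite /= !inE; case: hs => ->; lia.
  rewrite !big_cons big_nil /= addr0 !latticeZ_laplacianE eqxx mul1mx.
  have [-> ->] : (x == x + s) = false /\ (x == x - s) = false.
    by split; case: hs => ->; lia.
  have [-> ->] : latticeZ_adj x (x + s) /\ latticeZ_adj x (x - s).
    by rewrite /latticeZ_adj; split; case: hs => ->; lia.
  by rewrite !mulNmx -!scalemxAl addrA.
move=> z [_ /= zx]; rewrite latticeZ_laplacianE /latticeZ_adj.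
have /negP := zx; rewrite !inE => h.
have -> : (x == z) = false by lia.
have -> : (z == x + 1) || (z == x - 1) = false by case: hs h => ->; lia.
by rewrite mul0mx.
Qed.

Hypothesis hsigma : is_connection latticeZ_adj sigma.

Lemma connection_mulK s x : s = 1 \/ s = -1 ->
  sigma x (x + s) *m sigma (x + s) x = 1%:M.
Proof.
move=> hs; have adjx : latticeZ_adj x (x + s).
  by rewrite /latticeZ_adj; case: hs => ->; lia.
have [[_ ort] ->] := hsigma _ _ adjx.
(* [invmx] is a genuine inverse only on invertible matrices; orthogonality provides the
   invertibility. *)
by apply: mulmxV; have [] := mulmx1_unit ort.
Qed.

Lemma bexp_latticeZ_laplacian k (s x : int) a : s = 1 \/ s = -1 ->
  bexp (latticeZ_laplacian sigma) k x (x + s * a%:Z) =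
    ((-1) ^+ a * 2^-1 ^+ k * 'C(2 * k, k + a)%:R) *: transport s x a.
Proof.
elim: k s x a => [|k IHk] s x a hs.
  rewrite /= /bdiag muln0 add0n expr0 bin0n; case: a => [|a].
    by rewrite mulr0 addr0 eqxx /transport big_ord0 !mulr1 scale1r.
  have -> : (x == x + s * a.+1%:Z) = false by case: hs => ->; lia.
  by rewrite mulr0 scale0r.
have hNs : - s = 1 \/ - s = -1 by case: hs => ->; [right|left; rewrite opprK].
have connection_mulKN : sigma x (x - s) *m sigma (x - s) x = 1%:M.
  exact: connection_mulK.
rewrite [LHS](bmul_latticeZ_laplacian (bexp _ k) _ _ _ hs) IHk //.
case: a => [|a].
  (* The target [x] is one step from [x + s] in direction [- s] and one step from [x - s] in
     direction [s], so the induction hypothesis is needed for both signs. *)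
  have -> : x + s * 0%:Z = (x + s) + (- s) * 1%:Z by lia.
  rewrite IHk //.
  have -> : (x + s) + (- s) * 1%:Z = (x - s) + s * 1%:Z by lia.
  rewrite IHk // !transportS addrK subrK /transport !big_ord0 !mulmx1.
  rewrite -!scalemxAr connection_mulK // connection_mulKN.
  rewrite !scalerA -!scalerBl !addn0 addn1 bin_double_succ0
    natrD !natrM !exprS expr0.
  by congr (_ *: _); field.
have -> : x + s * a.+1%:Z = (x + s) + s * a%:Z by lia.
rewrite IHk //.
have -> : x + s + s * a%:Z = (x - s) + s * a.+2%:Z by lia.
(* The transport from [x - s] begins with the step back to [x], which cancels the step from [x] to
   [x - s]. *)
rewrite IHk // (transportS s (x - s)) subrK -!scalemxAr -transportS mulmxA.
rewrite connection_mulKN mul1mx !scalerA -!scalerBl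
  bin_double_succ 2!natrD natrM !exprS.
by congr (_ *: _); field.
Qed.

Lemma exp_term_latticeZ (t : R) (s x : int) a : s = 1 \/ s = -1 ->
  exp_term (latticeZ_laplacian sigma) t x (x + s * a%:Z) =
    fun k => ((-1) ^+ a * binom_term a t k) *: transport s x a.
Proof.
move=> hs; apply/funext => k.
rewrite /exp_term bexp_latticeZ_laplacian // scalerA /binom_term.
by rewrite -mulNr exprMn; congr (_ *: _); ring.
Qed.

End Transport.

Lemma leq_bin_exp2 n m : ('C(n, m) <= 2 ^ n)%N.
Proof.
elim: n m => [|n IHn] [|m]; rewrite ?bin0 ?expn_gt0 // binS expnS mul2n -addnn.
exact: leq_add.
Qed.

Lemma is_cvg_series_binom_term (R : realType) a (t : R) :
  cvgn (series (binom_term a t)).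
Proof.
apply: normed_cvg.
apply: (@series_le_cvg _ _ (exp_coeff (2 * `|t|))).
- by move=> k /=; exact: normr_ge0.
- by move=> k; rewrite exp_coeff_ge0 // mulr_ge0.
- move=> k; rewrite /binom_term /exp_coeff /= !normrM normrX normrN normrM.
  rewrite !normfV !normr_nat mulrAC ler_wpM2r ?invr_ge0 //.
  (* The factor [4 ^+ k] dominates the binomial coefficient, which is at most [2 ^ (2 * k)]. *)
  have -> : 2 * `|t| = 4 * (`|t| / 2) by field.
  rewrite [(4 * _) ^+ _]exprMn ler_wpM2r ?exprn_ge0 ?mulr_ge0 ?invr_ge0 //.
  by rewrite -natrX ler_nat (leq_trans (leq_bin_exp2 _ _)) // expnM.
- exact: is_cvg_series_exp_coeff.
Qed.

Lemma cvg_series_exp_term_latticeZ (R : realType) (d : nat)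
    (sigma : int -> int -> 'M[R]_d) (t : R) (s x : int) a :
  (0 < d)%N -> is_connection latticeZ_adj sigma -> s = 1 \/ s = -1 ->
  series (exp_term (latticeZ_laplacian sigma) t x (x + s * a%:Z)) @ \oo -->
    ((-1) ^+ a * limn (series (binom_term a t))) *: transport R d sigma s x a.
Proof.
(* Matrices of size [d.+1] form a normed module, where scaling is continuous. *)
case: d sigma => // d sigma _ hsigma hs.
have -> : series (exp_term (latticeZ_laplacian sigma) t x (x + s * a%:Z)) =
    fun n => ((-1) ^+ a * series (binom_term a t) n) *:
               transport R d.+1 sigma s x a.
  apply/funext => n; rewrite /series /= exp_term_latticeZ // mulr_sumr.
  by rewrite scaler_suml.
apply: cvgZr_tmp.
by apply: cvgMl_tmp; exact: is_cvg_series_binom_term.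
Qed.

Theorem theorem1 (R : realType) (d : nat) (hd : (1 <= d)%N)
    (sigma : int -> int -> 'M[R]_d) (hsigma : is_connection latticeZ_adj sigma)
    (t : R) (x : int) :
  let L := latticeZ_laplacian sigma in
  let H := heat_kernel L t in
  [/\ (forall y : int, cvgn (series (exp_term L t x y))),
      (forall a : nat, cvgn (series (binom_term a t))),
      H x x = limn (series (binom_term 0 t)) *: 1%:M
    & forall a : nat, (0 < a)%N ->
        H x (x + a%:Z) =
          ((-1) ^+ a * limn (series (binom_term a t))) *:
            \big[mulmx/1%:M]_(i < a) sigma (x + i%:Z) (x + i.+1%:Z)
        /\
        H x (x - a%:Z) =
          ((-1) ^+ a * limn (series (binom_term a t))) *:
            \big[mulmx/1%:M]_(i < a) sigma (x - i%:Z) (x - i.+1%:Z)].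
Proof.
move=> L H.
have cvgE s a := @cvg_series_exp_term_latticeZ R d sigma t s x a hd hsigma.
have HE s a : s = 1 \/ s = -1 -> H x (x + s * a%:Z) =
    ((-1) ^+ a * limn (series (binom_term a t))) *: transport R d sigma s x a.
  by move=> hs; apply: cvg_lim (cvgE _ _ hs).
split.
- move=> y.
  (* Every vertex lies on one of the two rays from [x], so the directed statement covers all
     blocks. *)
  have [s [hs ->]] : exists s, (s = 1 \/ s = -1) /\ y = x + s * `|y - x|%N%:Z.
    have [yx|xy] := leP x y; first by exists 1; split; [left | lia].
    by exists (-1); split; [right | lia].
  by apply/cvg_ex; eexists; exact: cvgE.
- by move=> a; exact: is_cvg_series_binom_term.
(* The diagonal block is the case of the empty walk; either direction would do. *)
- have := HE 1 0%N (or_introl erefl).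
  by rewrite mulr0 addr0 expr0 mul1r /transport big_ord0.
- move=> a _; split.
    have := HE 1 a (or_introl erefl); rewrite mul1r => ->.
    by congr (_ *: _); apply: eq_bigr => i _; rewrite !mul1r.
  have := HE (-1) a (or_intror erefl); rewrite mulN1r => ->.
  by congr (_ *: _); apply: eq_bigr => i _; rewrite !mulN1r.
Qed.
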